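(* Let $A$ be a field and $HA$ the ring of Hurwitz series over $A$. Let $h_0,h_1\in HA$ and consider the differential equation $\partial^2(y)+h_1\partial(y)+h_0y=0$ in $HA$. Let $y_1\in HA$ be an invertible element of $HA$ which is a solution of this equation, and let $y_2:=y_1\int\big(\exp(-\int h_1)\,y_1^{-2}\big)$. Then $y_1$ and $y_2$ are linearly independent over $A$, and the general solution of the equation is $$y=y_1\Big(c_1+c_2\int\big(\exp(-\int h_1)\,y_1^{-2}\big)\Big),\qquad c_1,c_2\in A,$$ i.e. the solutions are exactly the elements of this form.
   Context: $HA$ is the set of sequences $f=(f(0),f(1),\dots)$ with entries in $A$, with componentwise addition and product $(fg)(m)=\sum_{i=0}^m\binom{m}{i}f(i)g(m-i)$; its identity is $1=(1,0,0,\dots)$. The derivation is $\partial(f)=(f(1),f(2),\dots)$ and the integral is $\int f=(0,f(0),f(1),\dots)$. $y_1^{-2}$ denotes $(y_1^{-1})^2$. For $h\in HA$ the divided powers are $h^{[0]}=1$ and $h^{[n]}=\int(h^{[n-1]}\partial(h))$ for $n\ge1$. For $h$ with $h(0)=0$, $\exp(h)=\sum_{n\in\mathbb{N}}h^{[n]}$, the sum being taken componentwise (one has $h^{[n]}(i)=0$ for $i<n$, so each component is a finite sum). *)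

(* Defs.v *)
From HB Require Import structures.
From mathcomp Require Import all_boot all_order all_algebra.
From mathcomp Require Import boolp.

Set Implicit Arguments.
Unset Strict Implicit.
Unset Printing Implicit Defensive.

Import GRing.Theory.
Local Open Scope ring_scope.

(* A record rather than an alias of [nat -> A], so that the ring structure     *)
(* below cannot be confused with the pointwise one on functions.               *)
Record hurwitz (A : Type) := Hurwitz { hcoef :> nat -> A }.

Lemma hurwitzP (A : Type) (f g : hurwitz A) : f =1 g -> f = g.
Proof. by case: f g => [f] [g] /= /funext ->. Qed.

HB.instance Definition _ (A : Type) := gen_eqMixin (hurwitz A).
HB.instance Definition _ (A : Type) := gen_choiceMixin (hurwitz A).

Section HurwitzRing.
Variable A : comNzRingType.
Implicit Types f g h : hurwitz A.

Definition hzero : hurwitz A := Hurwitz (fun=> 0).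
Definition hone : hurwitz A := Hurwitz (fun m => (m == 0%N)%:R).
Definition hopp f : hurwitz A := Hurwitz (fun m => - f m).
Definition hadd f g : hurwitz A := Hurwitz (fun m => f m + g m).
Definition hmul f g : hurwitz A :=
  Hurwitz (fun m => \sum_(i < m.+1) 'C(m, i)%:R * f i * g (m - i)%N).
Definition hscale (a : A) f : hurwitz A := Hurwitz (fun m => a * f m).

Definition hderiv f : hurwitz A := Hurwitz (fun m => f m.+1).
Definition hint f : hurwitz A :=
  Hurwitz (fun m => if m is k.+1 then f k else 0).

Fact haddA : associative hadd.
Proof. by move=> f g h; apply: hurwitzP => m /=; rewrite addrA. Qed.
Fact haddC : commutative hadd.
Proof. by move=> f g; apply: hurwitzP => m /=; rewrite addrC. Qed.
Fact hadd0 : left_id hzero hadd.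
Proof. by move=> f; apply: hurwitzP => m /=; rewrite add0r. Qed.
Fact haddN : left_inverse hzero hopp hadd.
Proof. by move=> f; apply: hurwitzP => m /=; rewrite addNr. Qed.

HB.instance Definition _ :=
  GRing.isZmodule.Build (hurwitz A) haddA haddC hadd0 haddN.

Fact hmul0E f g : hmul f g 0%N = f 0%N * g 0%N.
Proof. by rewrite /= big_ord1 bin0 mul1r. Qed.

Fact hmulSE f g m :
  hmul f g m.+1 = hmul (hderiv f) g m + hmul f (hderiv g) m.
Proof.
rewrite /= big_ord_recl bin0 mul1r subn0.
rewrite (eq_bigr (fun i : 'I_m.+1 => 'C(m, i.+1)%:R * f i.+1 * g (m - i)%N
  + 'C(m, i)%:R * f i.+1 * g (m - i)%N)); last first.
  by move=> i _; rewrite !lift0 subSS binS natrD !mulrDl.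
rewrite big_split /= addrA addrC; congr (_ + _).
rewrite [in RHS]big_ord_recl bin0 mul1r subn0; congr (_ + _).
rewrite big_ord_recr /= bin_small // !mul0r addr0.
apply: eq_bigr => i _; rewrite /bump leq0n -subSn // subSS.
Qed.

Fact hmulDl : left_distributive hmul hadd.
Proof.
move=> f g h; apply: hurwitzP => m /=; rewrite -big_split /=.
by apply: eq_bigr => i _; rewrite mulrDr mulrDl.
Qed.

Fact hmulC : commutative hmul.
Proof.
move=> f g; apply: hurwitzP => m; elim: m f g => [|m IH] f g.
  by rewrite !hmul0E mulrC.
by rewrite !hmulSE addrC IH [in LHS]addrC IH addrC.
Qed.

Fact hderivM f g :
  hderiv (hmul f g) = hadd (hmul (hderiv f) g) (hmul f (hderiv g)).
Proof. by apply: hurwitzP => m; apply: hmulSE. Qed.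

Fact hmulDr : right_distributive hmul hadd.
Proof. by move=> f g h; rewrite hmulC hmulDl !(hmulC f). Qed.

Fact hmulA : associative hmul.
Proof.
move=> f g h; apply: hurwitzP => m; elim: m f g h => [|m IH] f g h.
  by rewrite !hmul0E mulrA.
have haddE (u v : hurwitz A) : hadd u v m = u m + v m by [].
by rewrite !hmulSE !hderivM hmulDl hmulDr !haddE !IH addrA.
Qed.

Fact hmul1 : left_id hone hmul.
Proof.
move=> f; apply: hurwitzP => m /=; rewrite big_ord_recl bin0 !mul1r subn0.
by rewrite big1 ?addr0 // => i _; rewrite mulr0 mul0r.
Qed.

Fact hone_neq0 : hone != hzero.
Proof.
by apply/eqP => /(congr1 (fun f : hurwitz A => f 0%N))/= /eqP; rewrite oner_eq0.
Qed.

HB.instance Definition _ := GRing.Zmodule_isComNzRing.Build (hurwitz A)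
  hmulA hmulC hmul1 hmulDl hone_neq0.

Fact hscaleA a b f : hscale a (hscale b f) = hscale (a * b) f.
Proof. by apply: hurwitzP => m /=; rewrite mulrA. Qed.
Fact hscale1 : left_id 1 hscale.
Proof. by move=> f; apply: hurwitzP => m /=; rewrite mul1r. Qed.
Fact hscaleDr : right_distributive hscale +%R.
Proof. by move=> a f g; apply: hurwitzP => m /=; rewrite mulrDr. Qed.
Fact hscaleDl f : {morph hscale^~ f : a b / a + b}.
Proof. by move=> a b; apply: hurwitzP => m /=; rewrite mulrDl. Qed.

HB.instance Definition _ := GRing.Zmodule_isLmodule.Build A (hurwitz A)
  hscaleA hscale1 hscaleDr hscaleDl.

Fact hscaleAl (a : A) (f g : hurwitz A) : a *: (f * g) = (a *: f) * g.
Proof.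
apply: hurwitzP => m /=; rewrite mulr_sumr.
by apply: eq_bigr => i _; rewrite !mulrA [a * _]mulrC.
Qed.

HB.instance Definition _ :=
  GRing.Lmodule_isLalgebra.Build A (hurwitz A) hscaleAl.
HB.instance Definition _ := GRing.Lalgebra_isComAlgebra.Build A (hurwitz A).

(* Units are the elements having an inverse; the inverse is obtained by choice *)
(* and, as everywhere in the hierarchy, [x^-1 = x] when [x] is not a unit.     *)
Definition hunit : pred (hurwitz A) := fun f => `[< exists g, g * f = 1 >].
Definition hinv f : hurwitz A :=
  if pselect (exists g, g * f = 1) is left ex then projT1 (cid ex) else f.

Fact hmulV : {in hunit, left_inverse 1 hinv *%R}.
Proof.
move=> f /asboolP ex; rewrite /hinv; case: pselect => // {}ex.
exact: projT2 (cid ex).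
Qed.
Fact hunitP f g : g * f = 1 -> hunit f.
Proof. by move=> gf1; apply/asboolP; exists g. Qed.
Fact hinv_out : {in [predC hunit], hinv =1 id}.
Proof.
by move=> f /negP nf; rewrite /hinv; case: pselect => // ex; case: nf; apply/asboolP.
Qed.

HB.instance Definition _ := GRing.ComNzRing_hasMulInverse.Build (hurwitz A)
  hmulV hunitP hinv_out.

Lemma hscalarE (a : A) m : (a%:A : hurwitz A) m = if m == 0%N then a else 0.
Proof. by rewrite /=; case: (m == 0%N); rewrite ?mulr1 ?mulr0. Qed.

Fixpoint hdivpow f (n : nat) : hurwitz A :=
  if n is k.+1 then hint (hdivpow f k * hderiv f) else 1.

(* The componentwise sum of the divided powers [hdivpow f n] over all [n]; the *)
(* terms with [n > m] vanish at [m], see [hdivpow_small]. The function is only *)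
(* meant for series with zero constant term.                                   *)
Definition hexp f : hurwitz A :=
  Hurwitz (fun m => \sum_(n < m.+1) hdivpow f n m).

Lemma hdivpow_small f n m : (m < n)%N -> hdivpow f n m = 0.
Proof.
elim: n m => [|n IH] [|m] //= ltmn; rewrite big1 // => i _.
by rewrite IH ?mulr0 ?mul0r // (leq_trans (ltn_ord i)).
Qed.

End HurwitzRing.

(* Main.v *)
Require Import Defs.
From HB Require Import structures.
From mathcomp Require Import all_boot all_order all_algebra.
From mathcomp Require Import ring.

Import GRing.Theory.
Local Open Scope ring_scope.

(** Reduction of order. Writing [y = y1 * z], the equation for [y] becomes the
first-order linear equation [w' = - h1 * w] for [w = y1 ^+ 2 * z']. Its
solutions are determined by their constant term, hence are the scalar
multiples of [exp (- int h1)]; dividing by [y1 ^+ 2] and integrating gives [z].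
Independence follows by comparing the first two coefficients. *)

Lemma hintK (A : comNzRingType) (f : hurwitz A) : hderiv (hint f) = f.
Proof. by apply: hurwitzP. Qed.

Lemma hderiv_inj0 (A : comNzRingType) (f g : hurwitz A) :
  hderiv f = hderiv g -> f 0%N = g 0%N -> f = g.
Proof.
move=> eq_fg eq0; apply: hurwitzP => -[|m] //.
by rewrite -[LHS]/(hderiv f m) eq_fg.
Qed.

Lemma hderivD (A : comNzRingType) (f g : hurwitz A) :
  hderiv (f + g) = hderiv f + hderiv g.
Proof. by apply: hurwitzP. Qed.

Lemma hderivZ (A : comNzRingType) (a : A) (f : hurwitz A) :
  hderiv (a *: f) = a *: hderiv f.
Proof. by apply: hurwitzP. Qed.

Lemma hderivC (A : comNzRingType) (a : A) : hderiv (a%:A : hurwitz A) = 0.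
Proof. by apply: hurwitzP => m; rewrite /= mulr0. Qed.

Lemma hderiv_mul (A : comNzRingType) (f g : hurwitz A) :
  hderiv (f * g) = hderiv f * g + f * hderiv g.
Proof. exact: hderivM. Qed.

Lemma hmul_coef0 (A : comNzRingType) (f g : hurwitz A) :
  (f * g) 0%N = f 0%N * g 0%N.
Proof. exact: hmul0E. Qed.

Lemma hexp_coef0 (A : comNzRingType) (h : hurwitz A) : hexp h 0%N = 1.
Proof. by rewrite /= big_ord1. Qed.

(** The added divided powers vanish at [i] by [hdivpow_small]. A truncation bound common to all
    [i <= m] allows exchanging sums in a product. *)
Lemma hexp_widen (A : comNzRingType) (h : hurwitz A) (i m : nat) :
  (i <= m)%N -> hexp h i = \sum_(n < m.+1) hdivpow h n i.
Proof.
move=> le_im; rewrite /= -!(big_mkord xpredT (fun n => hdivpow h n i)).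
rewrite [in RHS](@big_cat_nat _ _ _ i.+1) //=.
rewrite [X in _ + X]big_nat_cond [X in _ + X]big1 ?addr0 // => n.
by rewrite andbT => /andP[lt_in _]; rewrite hdivpow_small.
Qed.

Lemma hderiv_hexp (A : comNzRingType) (h : hurwitz A) :
  hderiv (hexp h) = hexp h * hderiv h.
Proof.
apply: hurwitzP => m.
(* The term [n = 0] is a coefficient of positive index of [1], hence zero; in the others the
   derivative cancels the integral defining the divided power. *)
rewrite /= big_ord_recl /= add0r exchange_big /=.
apply: eq_bigr => i _.
have le_im : (i <= m)%N by rewrite -ltnS.
rewrite -[X in _ * X * _]/(hexp h i) (hexp_widen _ _ _ _ le_im).
by rewrite mulr_sumr mulr_suml.
Qed.

(** The equation expresses [w m.+1] through [w 0, ..., w m] alone, so strong induction applies. *)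
Lemma hlinear1_eq0 (A : comNzRingType) (a w : hurwitz A) :
  hderiv w = a * w -> w 0%N = 0 -> w = 0.
Proof.
move=> dw w0; apply: hurwitzP => m.
elim/ltn_ind: m => -[|m] IH //.
rewrite -[LHS]/(hderiv w m) dw /= big1 // => i _.
by rewrite IH ?mulr0 // ltnS leq_subr.
Qed.

Lemma hlinear1P (A : comNzRingType) (a w : hurwitz A) :
  hderiv w = a * w <-> exists c : A, w = c *: hexp (hint a).
Proof.
have de c : hderiv (c *: hexp (hint a)) = a * (c *: hexp (hint a)).
  by rewrite hderivZ hderiv_hexp hintK mulrC scalerAr.
split=> [dw|[c ->]]; last exact: de.
(* The exponential has constant term [1], so this scalar makes the difference of the two solutions
   vanish at [0]. *)
exists (w 0%N); apply/eqP; rewrite -subr_eq0 -scaleN1r; apply/eqP.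
apply: (@hlinear1_eq0 _ a).
  by rewrite hderivD hderivZ dw de mulrDr scalerAr.
by rewrite -[LHS]/(w 0%N + -1 * (w 0%N * hexp _ 0%N)) hexp_coef0 mulr1 mulN1r subrr.
Qed.

(** The unit [y] is an integrating factor: multiplying the equation for [y * z] by it gives the
    first-order equation, and it can be cancelled again. *)
Lemma reduction_of_order (A : comNzRingType) (h0 h1 y z : hurwitz A) :
  y \is a GRing.unit ->
  hderiv (hderiv y) + h1 * hderiv y + h0 * y = 0 ->
  hderiv (hderiv (y * z)) + h1 * hderiv (y * z) + h0 * (y * z) = 0 <->
  hderiv (y ^+ 2 * hderiv z) = - h1 * (y ^+ 2 * hderiv z).
Proof.
move=> uy ysol.
set L := (X in X = 0 <-> _).
have yL : y * L = hderiv (y ^+ 2 * hderiv z) + h1 * (y ^+ 2 * hderiv z).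
  rewrite /L expr2 !(hderiv_mul, hderivD).
  (* Eliminating the second derivative of [y] makes the terms in [z] itself cancel, leaving a
     commutative ring identity. *)
  have -> : hderiv (hderiv y) = - (h1 * hderiv y + h0 * y).
    by apply/eqP; rewrite -addr_eq0 addrA ysol.
  by ring.
split=> [L0|dw].
  by apply/eqP; rewrite mulNr -addr_eq0 -yL L0 mulr0.
by apply: (mulrI uy); rewrite yL dw mulNr addNr mulr0.
Qed.

Theorem theorem4p8 (A : fieldType) (h0 h1 y1 : hurwitz A)
    (y1_unit : y1 \is a GRing.unit)
    (y1_sol : hderiv (hderiv y1) + h1 * hderiv y1 + h0 * y1 = 0) :
  let u : hurwitz A := hint (hexp (- hint h1) * y1^-1 ^+ 2) in
  let y2 : hurwitz A := y1 * u in
  (forall c1 c2 : A, c1 *: y1 + c2 *: y2 = 0 -> c1 = 0 /\ c2 = 0) /\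
  (forall y : hurwitz A,
     hderiv (hderiv y) + h1 * hderiv y + h0 * y = 0 <->
     exists c1 c2 : A, y = y1 * (c1%:A + c2 *: u)).
Proof.
move=> u y2.
have u0 : u 0%N = 0 by [].
have du : hderiv u = hexp (- hint h1) * y1^-1 ^+ 2 by rewrite hintK.
have intN : - hint h1 = hint (- h1).
  by apply: hurwitzP => -[|m] //; exact: oppr0.
split=> [c1 c2|y].
  rewrite /y2 scalerAr -[c1 *: y1]mulr1 -scalerAl scalerAr -mulrDr => y1z.
  have {y1z} z0 : c1%:A + c2 *: u = 0 :> hurwitz A.
    by apply: (mulrI y1_unit); rewrite y1z mulr0.
  have c10 : c1 = 0.
    have /(congr1 (fun f : hurwitz A => f 0%N)) := z0.
    by rewrite -[LHS]/(c1 * 1 + c2 * u 0%N) u0 mulr0 addr0 mulr1.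
  (* The constant term of the derivative is [c2] times the square of [y1^-1 0], which is nonzero
     because its product with [y1 0] is [1]. *)
  split=> //; have /(congr1 (fun f : hurwitz A => hderiv f 0%N)) := z0.
  rewrite hderivD hderivC add0r hderivZ du.
  rewrite -[LHS]/(c2 * (hexp _ * _) 0%N) hmul_coef0 hexp_coef0 mul1r expr2.
  rewrite hmul_coef0 => /eqP; rewrite mulf_eq0 => /orP[/eqP //|].
  rewrite mulf_eq0 orbb => /eqP v0.
  have /(congr1 (fun f : hurwitz A => f 0%N)) := mulVr y1_unit.
  by rewrite hmul_coef0 v0 mul0r => /esym/eqP; rewrite oner_eq0.
have y1K2 f : y1 ^+ 2 * (f * y1^-1 ^+ 2) = f.
  by rewrite mulrCA -exprMn mulrV // expr1n mulr1.
split=> [ysol|[c1 [c2 ->]]].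
  pose z := y1^-1 * y; have yE : y = y1 * z by rewrite mulrA mulrV ?mul1r.
  move: ysol; rewrite yE reduction_of_order // hlinear1P => -[c dz].
  (* Since [u] has no constant term, [c1] must be [z 0]; derivatives and constant terms then
     agree. *)
  exists (z 0%N), c; congr (_ * _); apply: hderiv_inj0.
    rewrite hderivD hderivC add0r hderivZ du intN scalerAl -dz.
    by apply: (mulrI (unitrX 2 y1_unit)); rewrite y1K2.
  by rewrite -[RHS]/(z 0%N * 1 + c * u 0%N) u0 mulr0 addr0 mulr1.
rewrite reduction_of_order // hlinear1P; exists c2.
by rewrite hderivD hderivC add0r hderivZ du scalerAl y1K2 intN.
Qed.
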